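(* Let $\Omega$ be an algebra of subsets of a set $X$ and $\mu$ a measure on $\Omega$ with $\mu(X)<\infty$. Let $(\overline{\Omega},\overline d)$ be the completion of $\Omega$ under the pseudometric $d(A,B)=\mu^{\ast}(A\triangle B)$, let $\widetilde{\mathbf S}_{/\sim}$ be the set of $\sim$-classes of limits of $\mu$-Cauchy sequences, metrized by $d$, and let $F$ be the map sending $\overline{\{B_n\}}\in\overline{\Omega}$ to the $\sim$-class of $\overline{\lim}\, B_{f(n)}$ (all as defined in the context). Then $F$ is an isometry between $\overline{\Omega}$ and $\widetilde{\mathbf S}_{/\sim}$; that is, $F:\overline{\Omega}\to\widetilde{\mathbf S}_{/\sim}$ is a bijection and $\overline d(E,E')=d(F(E),F(E'))$ for all $E,E'\in\overline{\Omega}$.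
   Context: Let $X$ be a set, $\Omega$ an algebra of subsets of $X$ (containing $X$ and $\emptyset$, closed under complements and finite unions), and $\mu$ a measure on the algebra $\Omega$ (nonnegative, $\mu(\emptyset)=0$, countably additive whenever a countable disjoint union of members of $\Omega$ lies in $\Omega$) with $\mu(X)<\infty$. Let $\mathbf P(X)$ be the power set of $X$. Outer measure: $\mu^{\ast}(A)=\inf\{\sum_{i}\mu(A_i) : A\subseteq\bigcup_{i\ge 1}A_i,\ A_i\in\Omega \text{ for all } i\ge 1\}$ for $A\in\mathbf P(X)$. One has $\mu^{\ast}|_{\Omega}=\mu$. Pseudometric: $d(A,B)=\mu^{\ast}(A\triangle B)$ on $\mathbf P(X)$. Write $A\sim B$ (or ''$A=B$ a.e.'') iff $\mu^{\ast}(A\triangle B)=0$; $d$ induces a metric, still denoted $d$, on $\mathbf P(X)_{/\sim}$. A $\mu$-Cauchy sequence is a sequence $\{B_n\}$ with $B_n\in\Omega$ and $\mu(B_n\triangle B_m)\to 0$ as $n,m\to\infty$. $\widetilde{\mathbf S}=\{S\in\mathbf P(X) : \text{there is a } \mu\text{-Cauchy sequence } \{B_n\} \text{ with } \lim_n\mu^{\ast}(B_n\triangle S)=0\}$, and $\widetilde{\mathbf S}_{/\sim}$ is its quotient by $\sim$, with the metric $d$. Completion: $\overline{\Omega}$ is the set of $\mu$-Cauchy sequences modulo the equivalence $\{A_n\}\sim\{B_n\}$ iff $\lim_n\mu(A_n\triangle B_n)=0$; the class of $\{B_n\}$ is $\overline{\{B_n\}}$. Its metric is $\overline d(\overline{\{A_n\}},\overline{\{B_n\}})=\lim_n\mu(A_n\triangle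 B_n)$. For a sequence of sets, $\overline{\lim}\, C_n=\bigcap_{m\ge 1}\bigcup_{n\ge m}C_n$. The map $F$: it is known that for every $\mu$-Cauchy sequence $\{B_n\}$ there is a function $f:\mathbb N\to\mathbb N$ with $f(n)>n$ for all $n$ such that $\lim_n\mu^{\ast}(B_n\triangle\overline{\lim}_k\, B_{f(k)})=0$. Define $F(\overline{\{B_n\}})=\overline{\lim}\, B_{f(n)}$ for any such $f$. This set lies in $\widetilde{\mathbf S}$ and its $\sim$-class does not depend on the choice of the representative $\{B_n\}$ or of $f$; $F$ is regarded as taking values in $\widetilde{\mathbf S}_{/\sim}$. *)

(* Defs.v *)
From HB Require Import structures.
From mathcomp Require Import all_boot all_order all_algebra.
From mathcomp Require Import generic_quotient.
From mathcomp Require Import all_classical all_reals all_analysis.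

Set Implicit Arguments.
Unset Strict Implicit.
Unset Printing Implicit Defensive.

Import Order.TTheory GRing.Theory Num.Theory.
Import numFieldNormedType.Exports.

Local Open Scope classical_set_scope.
Local Open Scope ring_scope.
Local Open Scope ereal_scope.
Local Open Scope measure_scope.
Local Open Scope quotient_scope.

Section completion.
Context {d : measure_display} {T : algebraOfSetsType d} {R : realType}.
Variable mu : {measure set T -> \bar R}.

(* Omega is the algebra of measurable sets of T, and mu^* is the library outer
   measure mu_ext: the infimum over countable covers by members of Omega. *)
Definition mu_cauchy (B : (set T)^nat) : Prop :=
  (forall n, measurable (B n)) /\
  mu (B nm.1 `+` B nm.2) @[nm --> (\oo, \oo)] --> 0.

Definition cauchy_seqs : set ((set T)^nat) := [set B | mu_cauchy B].

Definition S_tilde : set (set T) :=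
  [set S | exists2 B, mu_cauchy B & mu^* (B n `+` S) @[n --> \oo] --> 0].

Lemma mu_extY_triangle A B C :
  mu^* (A `+` C) <= mu^* (A `+` B) + mu^* (B `+` C).
Proof.
apply: le_trans (outer_measureU2 (mu^*) _ _); apply: le_mu_ext => x /=.
by have [] := pselect (B x); tauto.
Qed.

Lemma mu_extY_eq0 A B C :
  mu^* (A `+` B) = 0 -> mu^* (B `+` C) = 0 -> mu^* (A `+` C) = 0.
Proof.
move=> AB BC; apply/eqP; rewrite eq_le mu_ext_ge0// andbT.
by apply: (le_trans (mu_extY_triangle _ B _)); rewrite AB BC adde0.
Qed.

Lemma mu_extY_cvg0 (A B C : (set T)^nat) :
  mu^* (A n `+` B n) @[n --> \oo] --> 0 ->
  mu^* (B n `+` C n) @[n --> \oo] --> 0 ->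
  mu^* (A n `+` C n) @[n --> \oo] --> 0.
Proof.
move=> AB BC; apply: (@squeeze_cvge _ _ _ _ (cst 0) _
  (fun n => mu^* (A n `+` B n) + mu^* (B n `+` C n))).
- by apply: nearW => n; rewrite /= mu_ext_ge0//= mu_extY_triangle.
- exact: cvg_cst.
- by rewrite -[X in _ --> X]adde0; apply: cvgeD.
Qed.

Lemma mu_ext_symdiff (A B : (set T)^nat) :
  cauchy_seqs A -> cauchy_seqs B ->
  (fun n => mu (A n `+` B n)) = (fun n => mu^* (A n `+` B n)).
Proof.
move=> [mA _] [mB _]; apply/funext => n; rewrite measurable_mu_extE//.
by apply: measurableU; exact: measurableD.
Qed.

Lemma cauchy_seqsP (A : cauchy_seqs) : cauchy_seqs (val A).
Proof. by have := valP A; rewrite inE. Qed.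

Definition cauchy_equiv (A B : cauchy_seqs) : bool :=
  `[< mu (val A n `+` val B n) @[n --> \oo] --> 0 >].

Lemma cauchy_equiv_refl : reflexive cauchy_equiv.
Proof.
move=> A; apply/asboolP; under eq_fun do rewrite setYK measure0.
exact: cvg_cst.
Qed.

Lemma cauchy_equiv_sym : symmetric cauchy_equiv.
Proof.
by move=> A B; rewrite /cauchy_equiv; under eq_fun do rewrite setYC.
Qed.

Lemma cauchy_equiv_trans : transitive cauchy_equiv.
Proof.
move=> B A C; rewrite /cauchy_equiv.
rewrite !mu_ext_symdiff; try exact: cauchy_seqsP.
by move=> /asboolP AB /asboolP BC; apply/asboolP/(mu_extY_cvg0 AB BC).
Qed.

Canonical cauchy_equiv_rel := EquivRel cauchy_equiv
  cauchy_equiv_refl cauchy_equiv_sym cauchy_equiv_trans.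

Definition Omega_bar : Type := {eq_quot cauchy_equiv}.
HB.instance Definition _ := Choice.on Omega_bar.
HB.instance Definition _ := EqQuotient.on Omega_bar.

Definition ae_equiv (A B : S_tilde) : bool := mu^* (val A `+` val B) == 0.

Lemma ae_equiv_refl : reflexive ae_equiv.
Proof. by move=> A; rewrite /ae_equiv setYK mu_ext0. Qed.

Lemma ae_equiv_sym : symmetric ae_equiv.
Proof. by move=> A B; rewrite /ae_equiv setYC. Qed.

Lemma ae_equiv_trans : transitive ae_equiv.
Proof.
by move=> B A C /eqP AB /eqP BC; apply/eqP; exact: mu_extY_eq0 AB BC.
Qed.

Canonical ae_equiv_rel := EquivRel ae_equiv
  ae_equiv_refl ae_equiv_sym ae_equiv_trans.

Definition S_quot : Type := {eq_quot ae_equiv}.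
HB.instance Definition _ := Choice.on S_quot.
HB.instance Definition _ := EqQuotient.on S_quot.

Definition dist (A B : set T) : \bar R := mu^* (A `+` B).

(* The metrics on the quotients are computed on the canonical representatives;
   when mu is finite the value is independent of the representatives. *)
Definition dist_bar (E E' : Omega_bar) : \bar R :=
  limn (fun n => mu (val (repr E) n `+` val (repr E') n)).

Definition dist_quot (S S' : S_quot) : \bar R :=
  dist (val (repr S)) (val (repr S')).

Definition good_index (B : (set T)^nat) (f : nat -> nat) : Prop :=
  (forall n, (n < f n)%N) /\
  mu^* (B n `+` lim_sup_set (B \o f)) @[n --> \oo] --> 0.

Lemma cvg_mu_ext0 (A : (set T)^nat) :
  (forall r : R, (0 < r)%R ->
    exists N, forall n, (N <= n)%N -> mu^* (A n) <= r%:E) ->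
  mu^* (A n) @[n --> \oo] --> 0.
Proof.
move=> h; apply/fine_cvgP; split.
  have [N hN] := h 1%R ltr01; exists N => // n /= /hN An1.
  by rewrite ge0_fin_numE ?mu_ext_ge0// (le_lt_trans An1)// ltry.
apply/cvgrPdist_le => r r0; have [N hN] := h r r0.
exists N => // n /= /hN Anr; rewrite sub0r normrN ger0_norm ?fine_ge0 ?mu_ext_ge0//.
by rewrite -lee_fin fineK// ge0_fin_numE ?mu_ext_ge0// (le_lt_trans Anr)// ltry.
Qed.

Lemma exists_good_index (B : (set T)^nat) :
  mu_cauchy B -> exists f, good_index B f.
Proof.
move=> [mB cB].
have mY m n : measurable (B m `+` B n).
  by apply: measurableU; exact: measurableD.
have cauchyN (e : R) : (0 < e)%R -> exists N, forall m n, (N <= m)%N ->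
    (N <= n)%N -> mu^* (B m `+` B n) <= e%:E.
  move=> e0.
  have := cB [set x | x < e%:E] (open_ereal_lt' _).
  rewrite lte_fin => /(_ e0) [[P Q] /= [[N1 _ PN] [N2 _ QN]] PQ].
  exists (maxn N1 N2) => m n; rewrite !geq_max => /andP[N1m _] /andP[_ N2n].
  rewrite measurable_mu_extE//.
  apply: ltW; apply: (PQ (m, n)); split; [exact: PN|exact: QN].
pose e n : R := (2 ^- n)%R.
have e0 n : (0 < e n)%R by rewrite invr_gt0 exprn_gt0.
have /choice[N hN] := fun n => cauchyN _ (e0 n.+1).
pose f n := (n.+1 + \max_(i < n.+1) N i)%N.
have fN n : (N n <= f n)%N.
  by apply: leq_trans (leq_addl _ _); apply: (leq_bigmax (@ord_max n)).
have f_homo n : (f n <= f n.+1)%N.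
  by rewrite leq_add// [X in (_ <= X)%N]big_ord_recr/= leq_maxl.
exists f; split=> [n|]; first by rewrite /f addSn ltnS leq_addr.
set S := lim_sup_set _.
have tail n : mu^* (B (f n) `+` S) <= (e n)%:E.
  apply: (@le_trans _ _ (mu^* (\bigcup_j (B (f (n + j)%N) `+` B (f (n + j).+1))))).
    apply: le_mu_ext => x.
    apply: contraPP => nswitch.
    have stay j : B (f (n + j)%N) x <-> B (f n) x.
      elim: j => [|j IHj]; first by rewrite addn0.
      rewrite -IHj addnS; apply: contrapT => nBx; apply: nswitch.
      exists j => //=; have [] := pselect (B (f (n + j)%N) x);
        have [] := pselect (B (f (n + j).+1) x); tauto.
    suff : B (f n) x <-> S x by rewrite /=; tauto.
    split=> [Bx k _|/(_ n I)[j /= nj Bx]].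
      by exists (n + k)%N; rewrite /= ?leq_addl//; exact/stay.
    by apply/(stay (j - n)%N); rewrite subnKC.
  apply: le_trans (mu_ext_sigma_subadditive (measure_ge0 mu) _) _.
  have := @epsilon_trick R (fun=> 0) (e n) xpredT (fun=> lexx _) (ltW (e0 n)).
  rewrite [X in _ <= X + _](_ : _ = 0); last exact: eseries0.
  rewrite [leRHS]add0e; apply: le_trans.
  apply: lee_nneseries => [j _ _|j _]; first exact: mu_ext_ge0.
  rewrite [leRHS]add0e; apply: le_trans (hN (n + j)%N _ _ _ _) _ => //.
  - exact: leq_trans (fN _) (f_homo _).
  - by rewrite lee_fin /e natrX -invfM -exprD addnS.
apply: cvg_mu_ext0 => r r0.
have [k kr] : exists k, (e k.+1 + e k <= r)%R.
  have [k _ /(_ k (leqnn k)) /= kr] :=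
    near_infty_natSinv_lt (PosNum (divr_gt0 r0 (ltr0n R 2))).
  exists k; rewrite [r]splitr lerD// ltW//; apply: le_lt_trans kr.
    rewrite lef_pV2 ?posrE ?exprn_gt0// -natrX ler_nat.
    by rewrite ltnW// ltn_expl.
  by rewrite lef_pV2 ?posrE ?exprn_gt0// -natrX ler_nat ltn_expl.
exists (f k) => n fkn.
apply: le_trans (mu_extY_triangle _ (B (f k)) _) _.
apply: (@le_trans _ _ ((e k.+1)%:E + (e k)%:E)); last by rewrite lee_fin.
by apply: leeD => //; apply: hN => //; exact: leq_trans fkn.
Qed.

Lemma lim_sup_S_tilde (B : cauchy_seqs) f :
  good_index (val B) f -> lim_sup_set (val B \o f) \in S_tilde.
Proof.
by move=> [_ Bf]; rewrite inE; exists (val B) => //; exact: cauchy_seqsP.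
Qed.

(* The index function is chosen classically; FE below shows that the choice is
   immaterial. *)
Definition F_index (B : cauchy_seqs) : {f | good_index (val B) f} :=
  cid (exists_good_index (cauchy_seqsP B)).

Definition F (E : Omega_bar) : S_quot :=
  let B := repr E in
  \pi_S_quot (exist _ (lim_sup_set (val B \o sval (F_index B)))
                      (lim_sup_S_tilde (svalP (F_index B))) : S_tilde).

Lemma FE (B : cauchy_seqs) f (Bf : good_index (val B) f) :
  F (\pi_Omega_bar B) =
  \pi_S_quot (exist _ (lim_sup_set (val B \o f)) (lim_sup_S_tilde Bf) : S_tilde).
Proof.
rewrite /F; set A := repr _; case: (F_index A) => g /= Ag.
apply/eqmodP; rewrite /= /ae_equiv /=.
have /eqmodP/asboolP : A = B %[mod Omega_bar] by rewrite reprK.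
rewrite mu_ext_symdiff; [|exact: cauchy_seqsP..] => AB.
set S := lim_sup_set _; set S' := lim_sup_set _.
have : mu^* (S `+` S') @[_ --> \oo] --> 0.
  apply: (@mu_extY_cvg0 _ (fun n => val B n)); last exact: Bf.2.
  apply: (@mu_extY_cvg0 _ (fun n => val A n)) => //.
  by under eq_fun do rewrite setYC; exact: Ag.2.
by move/cvg_lim; rewrite lim_cst// => ->.
Qed.

End completion.

Arguments F {d T R} mu E.

(* Main.v *)
Require Import Defs.
From mathcomp Require Import all_boot all_order all_algebra.
From mathcomp Require Import all_classical all_reals all_analysis.

(** A point [E] of the completion is a Cauchy sequence [B], and the set chosen
    to represent [F E] is a limit of [B] in the pseudometric
    [mu^* (A `+` B)] ([F_cvg]): the limit superior is such a limit, and every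
    set a.e. equal to a limit is again a limit.  So [F] is nothing but the map
    that sends a Cauchy sequence to its limit, and the rest is the usual
    comparison between a completion and a closure.

    - Injectivity: two Cauchy sequences with the same limit are equivalent.
    - Surjectivity: a set in [S_tilde] is the limit of some Cauchy sequence [B]
      by definition, and [F] sends the class of [B] to a limit of [B]; limits
      are unique up to [mu^*]-null sets.
    - Isometry: a pseudometric is continuous for the convergence that it
      defines ([mu_extY_cvg]), hence [mu (A n `+` B n)] tends to
      [mu^* (S `+` S')] when [A] tends to [S] and [B] to [S'].  Finiteness of
      [mu] is what allows the triangle inequality to be subtracted. *)

Local Open Scope classical_set_scope.
Local Open Scope ring_scope.
Local Open Scope ereal_scope.
Local Open Scope measure_scope.
Local Open Scope quotient_scope.

Import Order.TTheory GRing.Theory Num.Theory.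

Section isometry.
Context {d : measure_display} {T : algebraOfSetsType d} {R : realType}.
Variable mu : {measure set T -> \bar R}.
Implicit Types (A B : (set T)^nat) (S : set T) (E : Omega_bar mu).

Lemma mu_ext_fin_num S : mu [set: T] < +oo -> mu^* S \is a fin_num.
Proof.
move=> mu_fin; rewrite ge0_fin_numE ?mu_ext_ge0//.
apply: le_lt_trans mu_fin; rewrite -measurable_mu_extE//.
exact: le_mu_ext.
Qed.

Lemma mu_extY_cvg_unique A S S' :
  mu^* (A n `+` S) @[n --> \oo] --> 0 ->
  mu^* (A n `+` S') @[n --> \oo] --> 0 ->
  mu^* (S `+` S') = 0.
Proof.
move=> AS AS'.
have : mu^* (S `+` S') @[_ --> \oo] --> 0.
  apply: (@mu_extY_cvg0 _ _ _ mu (fun=> S) A (fun=> S')) => //.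
  by under eq_fun do rewrite setYC.
by move/cvg_lim; rewrite lim_cst// => ->.
Qed.

Lemma mu_extY_cvg0_ae A S S' :
  mu^* (A n `+` S) @[n --> \oo] --> 0 -> mu^* (S `+` S') = 0 ->
  mu^* (A n `+` S') @[n --> \oo] --> 0.
Proof.
move=> AS SS'; apply: (@mu_extY_cvg0 _ _ _ mu A (fun=> S) (fun=> S')) => //.
by rewrite SS'; exact: cvg_cst.
Qed.

(** With [e n] the sum of the distances from [A n] to [S] and from [B n] to
    [S'], two triangle inequalities squeeze [mu^* (A n `+` B n)] between
    [mu^* (S `+` S') - e n] and [mu^* (S `+` S') + e n]. *)
Lemma mu_extY_cvg A B S S' : mu [set: T] < +oo ->
  mu^* (A n `+` S) @[n --> \oo] --> 0 ->
  mu^* (B n `+` S') @[n --> \oo] --> 0 ->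
  mu^* (A n `+` B n) @[n --> \oo] --> mu^* (S `+` S').
Proof.
move=> mu_fin AS BS'; have fin := @mu_ext_fin_num ^~ mu_fin.
pose e n := mu^* (A n `+` S) + mu^* (B n `+` S').
have e0 : e n @[n --> \oo] --> 0 by rewrite -[X in _ --> X]adde0; apply: cvgeD.
apply: (@squeeze_cvge _ _ _ _ (fun n => mu^* (S `+` S') - e n) _
  (fun n => mu^* (S `+` S') + e n)).
- apply: nearW => n; apply/andP; split.
    rewrite leeBlDr ?fin_numD ?fin//.
    apply: le_trans (mu_extY_triangle mu S (A n) S') _.
    rewrite setYC addeCA leeD2l//.
    exact: mu_extY_triangle.
  rewrite addeCA.
  apply: le_trans (mu_extY_triangle mu _ S _) _; rewrite leeD2l//.
  apply: le_trans (mu_extY_triangle mu _ S' _) _.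
  by rewrite [S' `+` _]setYC.
- rewrite -[X in _ --> X]sube0; apply: cvgeB => //; last exact: cvg_cst.
  by rewrite fin_num_adde_defr.
- rewrite -[X in _ --> X]adde0; apply: cvgeD => //; last exact: cvg_cst.
  by rewrite fin_num_adde_defr.
Qed.

(** Any good index sequence for [repr E] gives a limit superior to which
    [repr E] converges and whose class is [F mu E]; the representative of that
    class differs from the limit superior by a null set only. *)
Lemma F_cvg E :
  mu^* (val (repr E) n `+` val (repr (F mu E))) @[n --> \oo] --> 0.
Proof.
have [f Ef] := exists_good_index (cauchy_seqsP (repr E)).
apply: (mu_extY_cvg0_ae _ _ _ Ef.2).
have := FE Ef; rewrite reprK -[F mu E in LHS]reprK.
by move=> /eqmodP/eqP; rewrite setYC.
Qed.

Lemma F_inj : injective (F mu).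
Proof.
move=> E E' FEE'; rewrite -[E]reprK -[E']reprK.
apply/eqmodP/asboolP; rewrite mu_ext_symdiff; [|exact: cauchy_seqsP..].
apply: (@mu_extY_cvg0 _ _ _ mu _ (fun=> val (repr (F mu E)))).
  exact: F_cvg.
by rewrite FEE'; under eq_fun do rewrite setYC; exact: F_cvg.
Qed.

Lemma F_surj (S : S_quot mu) : exists E, F mu E = S.
Proof.
have := valP (repr S); rewrite inE => -[B cB BS].
pose B' : cauchy_seqs mu := exist _ B (mem_set cB).
exists (\pi_(Omega_bar mu) B'); set E := \pi_(_) _.
rewrite -[LHS]reprK -[RHS]reprK; apply/eqmodP/eqP.
have /eqmodP/asboolP : repr E = B' %[mod Omega_bar mu] by rewrite reprK.
rewrite mu_ext_symdiff; [|exact: cauchy_seqsP..] => EB.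
apply: (mu_extY_cvg_unique (val (repr E))); first exact: F_cvg.
exact: (@mu_extY_cvg0 _ _ _ mu _ B).
Qed.

Lemma F_isometry E E' : mu [set: T] < +oo ->
  dist_bar E E' = dist_quot (F mu E) (F mu E').
Proof.
move=> mu_fin; rewrite /dist_bar mu_ext_symdiff; [|exact: cauchy_seqsP..].
by apply: cvg_lim => //; apply: mu_extY_cvg => //; exact: F_cvg.
Qed.

End isometry.

Theorem theorem1 (d : measure_display) (T : algebraOfSetsType d) (R : realType)
    (mu : {measure set T -> \bar R}) (mu_fin : mu [set: T] < +oo) :
  bijective (F mu) /\
  (forall E E' : Omega_bar mu,
      dist_bar E E' = dist_quot (F mu E) (F mu E')).
Proof.
split; last by move=> E E'; exact: F_isometry.
have /choice[G GK] := @F_surj _ _ _ mu.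
by exists G => // E; apply: F_inj; rewrite GK.
Qed.
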